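(* Let $\mathbb{O} = (n, \mathbb{O}^+, \mathbb{O}^-)$ be any orientation, i.e. $\mathbb{O}^+, \mathbb{O}^- \subseteq [n]$ arbitrary, and let $\varepsilon \in \{\varnothing, -, +, \pm\}$. Then the set $\mathsf{IPIP}^{\varepsilon}(\mathbb{O}) \cap \mathsf{WOIP}(n)$ (resp. $\mathsf{DPIP}^{\varepsilon}(\mathbb{O}) \cap \mathsf{WOIP}(n)$) induces a sublattice of the lattice $(\mathsf{WOIP}(n), \preccurlyeq, \wedge_{\mathsf{WOIP}}, \vee_{\mathsf{WOIP}})$.
   Context: $[n] = \{1,\dots,n\}$; $\mathcal{P}(n)$ is the set of (reflexive) posets on $[n]$. For a poset $\vartriangleleft$, $a \vartriangleright b$ means $b \vartriangleleft a$; let ${\vartriangleleft}^{\mathsf{Inc}} = \{(a,b) : a\le b,\ a \vartriangleleft b\}$ and ${\vartriangleleft}^{\mathsf{Dec}} = \{(b,a) : a\le b,\ b \vartriangleleft a\}$. The weak order on $\mathcal{P}(n)$ is ${\vartriangleleft} \preccurlyeq {\blacktriangleleft}$ iff ${\vartriangleleft}^{\mathsf{Inc}} \supseteq {\blacktriangleleft}^{\mathsf{Inc}}$ and ${\vartriangleleft}^{\mathsf{Dec}} \subseteq {\blacktriangleleft}^{\mathsf{Dec}}$. A permutation $\sigma \in \mathfrak{S}(n)$ gives the total order $\vartriangleleft_\sigma$ with $u \vartriangleleft_\sigma v$ iff $\sigma^{-1}(u) \le \sigma^{-1}(v)$. The weak order on $\mathfrak{S}(n)$ is: $\sigma \preccurlyeq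 \tau$ iff every pair $a<b$ with $\sigma^{-1}(a)>\sigma^{-1}(b)$ also satisfies $\tau^{-1}(a)>\tau^{-1}(b)$; it is a lattice with meet $\wedge_{\mathfrak{S}}$ and join $\vee_{\mathfrak{S}}$. A linear extension of $\vartriangleleft$ is a permutation $\sigma$ with ${\vartriangleleft} \subseteq {\vartriangleleft_\sigma}$; a weak order maximal (minimal) linear extension means one that is greatest (least) in weak order among all linear extensions. For $\sigma \preccurlyeq \sigma'$ let ${\vartriangleleft_{[\sigma,\sigma']}} = {\vartriangleleft_\sigma} \cap {\vartriangleleft_{\sigma'}}$, and $\mathsf{WOIP}(n) = \{{\vartriangleleft_{[\sigma,\sigma']}} : \sigma \preccurlyeq \sigma'\}$. Under the weak order $\preccurlyeq$ on posets, $\mathsf{WOIP}(n)$ is a lattice with ${\vartriangleleft_{[\sigma,\sigma']}} \wedge_{\mathsf{WOIP}} {\vartriangleleft_{[\tau,\tau']}} = {\vartriangleleft_{[\sigma \wedge_{\mathfrak{S}} \tau,\, \sigma' \wedge_{\mathfrak{S}} \tau']}}$ and ${\vartriangleleft_{[\sigma,\sigma']}} \vee_{\mathsf{WOIP}} {\vartriangleleft_{[\tau,\tau']}} = {\vartriangleleft_{[\sigma \vee_{\mathfrak{S}} \tau,\, \sigma' \vee_{\mathfrak{S}} \tau']}}$. A subset induces a sublattice if it is closed under this meet and join. $\mathsf{IPIP}^{+}(\mathbb{O}) = \{{\vartriangleleft} \in \mathcal{P}(n) : \forall a<b<c \text{ with } b \in \mathbb{O}^+,\ a \vartriangleleft c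 \Rightarrow a \vartriangleleft b\}$; $\mathsf{IPIP}^{-}(\mathbb{O}) = \{{\vartriangleleft} \in \mathcal{P}(n) : \forall a<b<c \text{ with } b \in \mathbb{O}^-,\ a \vartriangleleft c \Rightarrow b \vartriangleleft c\}$; $\mathsf{IPIP}^{\pm}(\mathbb{O}) = \mathsf{IPIP}^{+}(\mathbb{O}) \cap \mathsf{IPIP}^{-}(\mathbb{O})$; $\mathsf{DPIP}^{+}(\mathbb{O}) = \{{\vartriangleleft} \in \mathcal{P}(n) : \forall a<b<c \text{ with } b \in \mathbb{O}^+,\ a \vartriangleright c \Rightarrow b \vartriangleright c\}$; $\mathsf{DPIP}^{-}(\mathbb{O}) = \{{\vartriangleleft} \in \mathcal{P}(n) : \forall a<b<c \text{ with } b \in \mathbb{O}^-,\ a \vartriangleright c \Rightarrow a \vartriangleright b\}$; $\mathsf{DPIP}^{\pm}(\mathbb{O}) = \mathsf{DPIP}^{+}(\mathbb{O}) \cap \mathsf{DPIP}^{-}(\mathbb{O})$. For $\varepsilon = \varnothing$: $\mathsf{IPIP}^{\varnothing}(\mathbb{O}) = \mathsf{IPIP}(\mathbb{O})$ is the set of posets in $\mathcal{P}(n)$ that admit a weak order maximal linear extension in which there are no $a<b<c$ such that $b \in \mathbb{O}^+$ and the values $b,a,c$ appear in this order from left to right, and no $a<b<c$ such that $b \in \mathbb{O}^-$ and $a,c,b$ appear in this order; $\mathsf{DPIP}^{\varnothing}(\mathbb{O}) = \mathsf{DPIP}(\mathbb{O})$ is the set of posets in $\mathcal{P}(n)$ that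 admit a weak order minimal linear extension in which there are no $a<b<c$ such that $b \in \mathbb{O}^+$ and $b,c,a$ appear in this order, and no $a<b<c$ such that $b \in \mathbb{O}^-$ and $c,a,b$ appear in this order. *)

(* Defs.v *)
From HB Require Import structures.
From mathcomp Require Import all_boot all_order all_fingroup.
From mathcomp Require Import zify.

Set Implicit Arguments.
Unset Strict Implicit.
Unset Printing Implicit Defensive.

Import Order.Theory.

Fact weak_display : Order.disp_t. Proof. exact: (Order.Disp tt tt). Qed.

(* Throughout, [n] is encoded as 'I_n, i.e. shifted down to {0, ..., n-1}.    *)

(* Alias of 'S_n carrying the weak order.                                     *)
Definition wperm (n : nat) := {perm 'I_n}.

HB.instance Definition _ n := Finite.on (wperm n).

(* The position of the value u in the word s(0) s(1) ... s(n-1).              *)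
Definition pos n (s : wperm n) (u : 'I_n) : 'I_n := ((s : 'S_n)^-1)%g u.

Definition wperm_le n : rel (wperm n) := fun s t =>
  [forall a : 'I_n, forall b : 'I_n, (a < b) && (pos s b < pos s a) ==>
    (pos t b < pos t a)].

Section WeakOrder.
Variable n : nat.
Implicit Types (s t r : wperm n) (a b c : 'I_n).

Let inv s a b := (a < b) && (pos s b < pos s a).

Lemma wperm_leP s t :
  reflect (forall a b, inv s a b -> inv t a b) (wperm_le s t).
Proof.
apply: (iffP forallP) => [H a b /[dup] h /andP [ab _]|H a].
  by rewrite /inv ab; move/forallP/(_ b)/implyP: (H a); apply.
by apply/forallP => b; apply/implyP => /H /andP [].
Qed.

Lemma pos_inj s : injective (pos s).
Proof. exact: perm_inj. Qed.

Lemma pos_neq s a b : a != b -> (pos s a : nat) != pos s b.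
Proof. by apply: contra_neq => /val_inj /pos_inj. Qed.

Lemma pos_ltE s a b :
  (pos s a < pos s b) = if a < b then ~~ inv s a b else inv s b a.
Proof.
rewrite /inv; case: (ltngtP a b) => /= [ab|ab|/val_inj ->]; last by rewrite !ltnn.
  have : a != b by rewrite neq_ltn ab.
  by move/(pos_neq s); case: ltngtP.
by [].
Qed.

Lemma inv_inj s t : (forall a b, inv s a b = inv t a b) -> s = t.
Proof.
move=> H; have E a b : (pos s a < pos s b) = (pos t a < pos t b).
  by rewrite !pos_ltE !H.
have card r u : #|[pred v | pos r v < pos r u]| = pos r u.
  have -> : #|[pred v | pos r v < pos r u]| = #|[pred i : 'I_n | i < pos r u]|.
    rewrite -(card_image (@pos_inj r)); apply: eq_card => i; rewrite inE.
    apply/imageP/idP => [[v vu ->] //|iu].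
    by exists ((r : 'S_n) i); rewrite ?inE /pos permK.
  rewrite cardE /enum_mem -enumT /=.
  rewrite -(size_map val) -(filter_map _ (fun i => i < pos r u)) val_enum_ord.
  rewrite size_filter -[n in iota 0 n](subnKC (ltnW (ltn_ord (pos r u)))).
  rewrite iotaD count_cat add0n.
  rewrite (_ : count _ (iota 0 _) = pos r u); last first.
    rewrite -[RHS](size_iota 0); apply/eqP; rewrite -all_count.
    by apply/allP => i; rewrite mem_iota.
  rewrite (_ : count _ _ = 0) ?addn0 //; apply/eqP; rewrite -leqn0 leqNgt -has_count.
  by apply/hasPn => i; rewrite mem_iota -leqNgt => /andP [].
have P u : pos s u = pos t u.
  by apply/val_inj; rewrite /= -(card s) -(card t); apply: eq_card => v; rewrite !inE E.
by apply: (can_inj invgK); apply/permP => u; exact: P.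
Qed.

Fact wperm_le_refl : reflexive (@wperm_le n).
Proof. by move=> s; apply/wperm_leP. Qed.

Fact wperm_le_anti : antisymmetric (@wperm_le n).
Proof.
move=> s t /andP [/wperm_leP st /wperm_leP ts]; apply: inv_inj => a b.
by apply/idP/idP => [/st|/ts].
Qed.

Fact wperm_le_trans : transitive (@wperm_le n).
Proof.
by move=> s t r /wperm_leP ts /wperm_leP sr; apply/wperm_leP => a b /ts /sr.
Qed.

(* A relation that is transitive and cotransitive along < is the inversion    *)
(* relation of a permutation.                                                 *)
Lemma inv_exists (I : rel 'I_n) :
    (forall a b, I a b -> a < b) -> transitive I ->
    (forall a b c, a < b < c -> I a c -> I a b || I b c) ->
  exists s, forall a b, inv s a b = I a b.
Proof.
move=> Ilt Itr Icotr.
pose lt a b := if a < b then ~~ I a b else I b a.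
have ltxx a : lt a a = false.
  by rewrite /lt ltnn; apply/negP => /Ilt; rewrite ltnn.
have lt_total a b : a != b -> lt a b || lt b a.
  by rewrite /lt -(inj_eq val_inj) /=; case: ltngtP => //= _ _;
     [rewrite orNb | rewrite orbN].
have lt_trans : transitive lt.
  move=> b a c; rewrite /lt.
  case: (ltngtP a b) => [ab|ba|/val_inj <-]; last by move/Ilt; rewrite ltnn.
    case: (ltngtP b c) => [bc|cb|/val_inj <-]; last by move=> _ /Ilt; rewrite ltnn.
      rewrite (ltn_trans ab bc) => nab nbc; apply/negP => ac.
      have abc : a < b < c by rewrite ab.
      by move: (Icotr a b c abc ac); rewrite (negPf nab) (negPf nbc).
    case: (ltngtP a c) => [ac|ca|/val_inj <-] nab Icb.
    - by apply: contra nab => Iac; exact: Itr Iac Icb.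
    - have cab : c < a < b by rewrite ca.
      by move: (Icotr c a b cab Icb); rewrite (negPf nab) orbF.
    - by rewrite Icb in nab.
  case: (ltngtP b c) => [bc|cb|/val_inj <-]; last by move=> _ /Ilt; rewrite ltnn.
    case: (ltngtP a c) => [ac|ca|/val_inj <-] Iba nbc.
    - by apply: contra nbc; apply: Itr.
    - have bca : b < c < a by rewrite bc.
      by move: (Icotr b c a bca Iba); rewrite (negPf nbc).
    - by rewrite Iba in nbc.
  rewrite ltnNge (ltnW (ltn_trans cb ba)) /= => Iba Icb.
  exact: Itr Icb Iba.
have rk_lt u : #|[pred v | lt v u]| < n.
  rewrite -[X in _ < X]card_ord; apply: proper_card; apply/properP.
  split; first exact/subsetP.
  by exists u; rewrite ?inE ?ltxx.
pose rk u := Ordinal (rk_lt u).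
have rk_mono a b : lt a b -> rk a < rk b.
  move=> ab /=; apply: proper_card; apply/properP; split.
    by apply/subsetP => v; rewrite !inE => va; exact: lt_trans va ab.
  by exists a; rewrite !inE ?ltxx.
have rk_inj : injective rk.
  move=> a b E; apply/eqP; apply/negPn/negP => /lt_total /orP [] /rk_mono;
    by rewrite E ltnn.
have rkE a b : (rk a < rk b) = lt a b.
  apply/idP/idP => [|/rk_mono //]; apply: contraTT => nab.
  have [<-|/lt_total] := eqVneq a b; first by rewrite ltnn.
  by rewrite (negPf nab) /= => /rk_mono /ltnW; rewrite leqNgt.
exists (perm rk_inj)^-1%g => a b.
rewrite /inv /pos invgK !permE rkE /lt.
case: (ltngtP a b) => [ab|ba|/val_inj ->] //=.
  by apply/esym/negP => /Ilt; rewrite ltnNge ltnW.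
by apply/esym/negP => /Ilt; rewrite ltnn.
Qed.

Lemma join_exists s t :
  exists r, forall q, wperm_le r q = wperm_le s q && wperm_le t q.
Proof.
pose R a b := inv s a b || inv t a b.
have Rlt a b : R a b -> a < b by case/orP => /andP [].
have cle a b : connect R a b -> a <= b.
  case/connectP => p + ->; elim: p a => //= x p IH a /andP [/Rlt ax /IH].
  exact/leq_trans/ltnW.
have inv_cotr r a b c : a < b < c -> inv r a c -> inv r a b || inv r b c.
  case/andP => ab bc; rewrite /inv ab bc (ltn_trans ab bc) /= => ca.
  by case: (ltnP (pos r b) (pos r a)) => //= /(leq_trans ca).
have Rcotr a b c : a < b < c -> R a c -> R a b || R b c.
  by move=> abc; rewrite /R => /orP [] /(inv_cotr _ _ _ _ abc) /orP [] ->;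
     rewrite ?orbT.
pose I a b := (a < b) && connect R a b.
have [||a b c|r Hr] := @inv_exists I.
- by move=> a b /andP [].
- move=> b a c /andP [ab Cab] /andP [bc Cbc].
  by rewrite /I (ltn_trans ab bc) (connect_trans Cab).
- case/andP => ab bc; rewrite /I ab bc /= => /andP [_].
  case/connectP => p + E; elim: p a ab E => /= [|x p IH] a ab E.
    by move: (ltn_trans ab bc); rewrite E ltnn.
  case/andP => Rax Pxp.
  have Cxc : connect R x c by apply/connectP; exists p.
  case: (ltngtP b x) => [bx|xb|/val_inj ->]; last by rewrite Cxc orbT.
    have abx : a < b < x by rewrite ab.
    case/orP: (Rcotr _ _ _ abx Rax) => [/connect1 -> //|/connect1 Cbx].
    by rewrite (connect_trans Cbx Cxc) orbT.
  case/orP: (IH x xb E Pxp) => [Cxb|->]; last by rewrite orbT.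
  by rewrite (connect_trans (connect1 Rax) Cxb).
exists r => q; apply/wperm_leP/andP => [H|[/wperm_leP sq /wperm_leP tq] a b].
  split; apply/wperm_leP => a b ab; apply: H; rewrite Hr /I.
    by rewrite Rlt ?connect1 /R ?ab.
  by rewrite Rlt ?connect1 /R ?ab ?orbT.
have Rq x y : R x y -> inv q x y by case/orP => [/sq|/tq].
rewrite Hr => /andP [+ /connectP [p + E]].
elim: p a E => /= [|x p IH] a E ab; first by rewrite E ltnn in ab.
case/andP => /Rq ax xp; have [Exb|nxb] := eqVneq x b; first by rewrite -Exb.
have Cxb : connect R x b by apply/connectP; exists p.
have xb : x < b by rewrite ltn_neqAle nxb cle.
move: (IH x E xb xp) ax; rewrite /inv ab /=.
by move=> /andP [_ h1] /andP [_ h2]; exact: ltn_trans h1 h2.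
Qed.

(* Reversing the word of a permutation complements its inversions.            *)
Let wrev s : wperm n := (perm (@rev_ord_inj n) * s)%g.

Lemma wrev_le s t : wperm_le (wrev s) (wrev t) = wperm_le t s.
Proof.
have Ei r a b : inv (wrev r) a b = (a < b) && ~~ inv r a b.
  have Ep u : pos (wrev r) u = rev_ord (pos r u).
    apply: (@perm_inj _ (wrev r)); rewrite /pos permKV /wrev permM permE.
    by rewrite rev_ordK permKV.
  rewrite /inv !Ep /=; case: (ltnP a b) => //= ab.
  have /(pos_neq r) : a != b by rewrite neq_ltn ab.
  by have := ltn_ord (pos r a); have := ltn_ord (pos r b); lia.
apply/wperm_leP/wperm_leP => H a b; last first.
  by rewrite !Ei => /andP [-> /=]; apply/contra/H.
move=> /[dup] ab /andP [lab _]; apply: contraTT ab => ab.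
by move: (H a b); rewrite !Ei lab /= => /(_ ab).
Qed.

Lemma wrevK : involutive wrev.
Proof. by move=> s; apply/permP => i; rewrite /wrev !permM !permE rev_ordK. Qed.

Lemma meet_exists s t :
  exists r, forall q, wperm_le q r = wperm_le q s && wperm_le q t.
Proof.
have [r Hr] := join_exists (wrev s) (wrev t).
by exists (wrev r) => q; rewrite -[q]wrevK !wrev_le Hr -!(wrev_le (wrev q)) !wrevK.
Qed.

Lemma meet_existsb s t :
  exists r, [forall q, wperm_le q r == wperm_le q s && wperm_le q t].
Proof. by have [r Hr] := meet_exists s t; exists r; apply/forallP => q; rewrite Hr. Qed.

Lemma join_existsb s t :
  exists r, [forall q, wperm_le r q == wperm_le s q && wperm_le t q].
Proof. by have [r Hr] := join_exists s t; exists r; apply/forallP => q; rewrite Hr. Qed.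

Definition wperm_meet s t : wperm n := xchoose (meet_existsb s t).
Definition wperm_join s t : wperm n := xchoose (join_existsb s t).

Fact wperm_meetP q s t :
  wperm_le q (wperm_meet s t) = wperm_le q s && wperm_le q t.
Proof. by have /forallP/(_ q)/eqP := xchooseP (meet_existsb s t). Qed.

Fact wperm_joinP s t q :
  wperm_le (wperm_join s t) q = wperm_le s q && wperm_le t q.
Proof. by have /forallP/(_ q)/eqP := xchooseP (join_existsb s t). Qed.

End WeakOrder.

HB.instance Definition _ n := Order.Le_isPOrder.Build weak_display (wperm n)
  (@wperm_le_refl n) (@wperm_le_anti n) (@wperm_le_trans n).

HB.instance Definition _ n :=
  Order.POrder_MeetJoin_isLattice.Build weak_display (wperm n)
    (@wperm_meetP n) (@wperm_joinP n).

Definition is_poset n (r : {set 'I_n * 'I_n}) : bool :=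
  [&& [forall a, (a, a) \in r],
      [forall a, forall b, ((a, b) \in r) && ((b, a) \in r) ==> (a == b)]
    & [forall a, forall b, forall c,
         ((a, b) \in r) && ((b, c) \in r) ==> ((a, c) \in r)]].

Record poset (n : nat) := Poset {
  poset_set : {set 'I_n * 'I_n};
  poset_setP : is_poset poset_set
}.

HB.instance Definition _ n := [isSub for @poset_set n].
HB.instance Definition _ n := [Finite of poset n by <:].

Definition poset_rel n (p : poset n) (a b : 'I_n) : bool :=
  (a, b) \in poset_set p.
Coercion poset_rel : poset >-> Funclass.

Definition poset_inc n (p : poset n) : {set 'I_n * 'I_n} :=
  [set (ab.1, ab.2) | ab : 'I_n * 'I_n & (ab.1 <= ab.2) && p ab.1 ab.2].

Definition poset_dec n (p : poset n) : {set 'I_n * 'I_n} :=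
  [set (ab.2, ab.1) | ab : 'I_n * 'I_n & (ab.1 <= ab.2) && p ab.2 ab.1].

Definition poset_le n : rel (poset n) := fun p q =>
  (poset_inc q \subset poset_inc p) && (poset_dec p \subset poset_dec q).

Section PosetOrder.
Variable n : nat.
Implicit Types (p q : poset n) (a b : 'I_n).

Lemma in_poset_inc p a b : ((a, b) \in poset_inc p) = (a <= b) && p a b.
Proof.
apply/imsetP/idP => [[[c d]] + [-> ->]|H]; first by rewrite inE.
by exists (a, b); rewrite ?inE.
Qed.

Lemma in_poset_dec p a b : ((b, a) \in poset_dec p) = (a <= b) && p b a.
Proof.
apply/imsetP/idP => [[[c d]] + [-> ->]|H]; first by rewrite inE.
by exists (a, b); rewrite ?inE.
Qed.

Fact poset_le_refl : reflexive (@poset_le n).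
Proof. by move=> p; rewrite /poset_le !subxx. Qed.

Fact poset_le_anti : antisymmetric (@poset_le n).
Proof.
move=> p q /andP [/andP [i1 d1] /andP [i2 d2]].
have Ei : poset_inc p = poset_inc q by apply/eqP; rewrite eqEsubset i2.
have Ed : poset_dec p = poset_dec q by apply/eqP; rewrite eqEsubset d1.
apply/val_inj/setP => -[a b] /=; case: (leqP a b) => ab.
  by have := in_poset_inc p a b; rewrite Ei in_poset_inc ab.
by have := in_poset_dec p b a; rewrite Ed in_poset_dec ltnW.
Qed.

Fact poset_le_trans : transitive (@poset_le n).
Proof.
move=> q p r /andP [i1 d1] /andP [i2 d2].
by rewrite /poset_le (subset_trans i2 i1) (subset_trans d1 d2).
Qed.

End PosetOrder.

HB.instance Definition _ n := Order.Le_isPOrder.Build weak_display (poset n)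
  (@poset_le_refl n) (@poset_le_anti n) (@poset_le_trans n).

Definition perm_set n (s : wperm n) : {set 'I_n * 'I_n} :=
  [set uv | pos s uv.1 <= pos s uv.2].

Lemma itv_is_poset n (s t : wperm n) : is_poset (perm_set s :&: perm_set t).
Proof.
apply/and3P; split; apply/forallP => a; first by rewrite !inE !leqnn.
  apply/forallP => b; rewrite !inE -!andbA; apply/implyP => /and4P [h _ h' _].
  by apply/eqP/(@pos_inj _ s)/val_inj/eqP; rewrite eqn_leq h.
apply/forallP => b; apply/forallP => c; rewrite !inE -!andbA.
apply/implyP => /and4P [h1 h2 h3 h4].
by rewrite (leq_trans h1 h3) (leq_trans h2 h4).
Qed.

(* The intersection of the total orders of s and t; it is the interval poset  *)
(* of [s, t] when s <= t.                                                     *)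
Definition itv_poset n (s t : wperm n) : poset n := Poset (itv_is_poset s t).

Definition is_woip n (p : poset n) : bool :=
  [exists s : wperm n, exists t : wperm n, (s <= t)%O && (p == itv_poset s t)].

Record woip (n : nat) := Woip {
  woip_poset :> poset n;
  woip_posetP : is_woip woip_poset
}.

HB.instance Definition _ n := [isSub for @woip_poset n].
HB.instance Definition _ n := [Finite of woip n by <:].
HB.instance Definition _ n :=
  [SubChoice_isSubPOrder of woip n by <: with weak_display].

Lemma itv_is_woip n (s t : wperm n) : (s <= t)%O -> is_woip (itv_poset s t).
Proof.
by move=> st; apply/existsP; exists s; apply/existsP; exists t; rewrite st eqxx.
Qed.

Definition itv_woip n (s t : wperm n) (st : (s <= t)%O) : woip n :=
  Woip (itv_is_woip st).

Section WoipLattice.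
Variable n : nat.
Implicit Types (p q r : woip n) (s t : wperm n).

Lemma itv_le s s' t t' (le_s : (s <= s')%O) (le_t : (t <= t')%O) :
  (itv_woip le_s <= itv_woip le_t)%O = (s <= t)%O && (s' <= t')%O.
Proof.
rewrite -[LHS]/(poset_le (itv_poset s s') (itv_poset t t')) /poset_le.
have inc (u u' : wperm n) (a b : 'I_n) : (u <= u')%O -> a < b ->
    ((a, b) \in poset_inc (itv_poset u u')) = ~~ (pos u' b < pos u' a).
  move=> /wperm_leP lu ab; rewrite in_poset_inc /poset_rel /= !inE /= ltnW //=.
  rewrite -leqNgt andbC; case: leqP => //= h; rewrite leqNgt; apply/negP => h'.
  by have := lu a b; rewrite ab h' ltnNge h => /(_ isT).
have dec (u u' : wperm n) (a b : 'I_n) : (u <= u')%O -> a < b ->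
    ((b, a) \in poset_dec (itv_poset u u')) = (pos u b < pos u a).
  move=> /wperm_leP lu ab; rewrite in_poset_dec /poset_rel /= !inE /= ltnW //=.
  have ne : (pos u a : nat) != pos u b by apply: pos_neq; rewrite neq_ltn ab.
  have -> : (pos u b <= pos u a) = (pos u b < pos u a) by rewrite ltn_neqAle eq_sym ne.
  by case: ltnP => //= h; have := lu a b; rewrite ab h => /(_ isT) /ltnW.
rewrite andbC; congr (_ && _); apply/subsetP/wperm_leP => H.
- move=> a b /andP [ab h]; rewrite ab -(dec t t') // H // dec //.
- case=> b a h; have := h; rewrite in_poset_dec => /andP [+ _].
  rewrite leq_eqVlt => /orP [/eqP/val_inj ->|ab].
    by rewrite in_poset_dec leqnn /poset_rel /= !inE /= !leqnn.
  rewrite dec //; rewrite dec // in h.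
  by have := H a b; rewrite ab h => /(_ isT).
- move=> a b /andP [ab h]; rewrite ab; apply: contraLR h => h.
  by rewrite -(inc s) // H // inc.
- case=> a b h; have := h; rewrite in_poset_inc => /andP [+ _].
  rewrite leq_eqVlt => /orP [/eqP/val_inj ->|ab].
    by rewrite in_poset_inc leqnn /poset_rel /= !inE /= !leqnn.
  rewrite inc //; rewrite inc // in h; apply: contra h => h.
  by have := H a b; rewrite ab h => /(_ isT).
Qed.

Lemma woip_itv p :
  exists st : wperm n * wperm n,
    (st.1 <= st.2)%O && (woip_poset p == itv_poset st.1 st.2).
Proof.
by case/existsP: (woip_posetP p) => s /existsP [t H]; exists (s, t).
Qed.

(* The endpoints of the interval represented by p; itv_endpoints below shows  *)
(* that they are unique.                                                      *)
Definition woip_min p : wperm n := (xchoose (woip_itv p)).1.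
Definition woip_max p : wperm n := (xchoose (woip_itv p)).2.

Lemma woip_min_max p : (woip_min p <= woip_max p)%O.
Proof. by case/andP: (xchooseP (woip_itv p)). Qed.

Lemma woipE p : itv_woip (woip_min_max p) = p.
Proof. by apply/val_inj/esym/eqP; case/andP: (xchooseP (woip_itv p)). Qed.

Lemma woip_leE p q :
  (p <= q)%O = (woip_min p <= woip_min q)%O && (woip_max p <= woip_max q)%O.
Proof. by rewrite -{1}(woipE p) -{1}(woipE q) itv_le. Qed.

Lemma itv_endpoints s t (st : (s <= t)%O) :
  woip_min (itv_woip st) = s /\ woip_max (itv_woip st) = t.
Proof.
have E := woipE (itv_woip st).
have := lexx (itv_woip st); rewrite -{1}E itv_le => /andP [h1 h2].
have := lexx (itv_woip st); rewrite -{2}E itv_le => /andP [h3 h4].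
by split; apply/le_anti; rewrite ?h1 ?h2.
Qed.

Definition woip_meet p q : woip n :=
  itv_woip (leI2 (woip_min_max p) (woip_min_max q)).

Definition woip_join p q : woip n :=
  itv_woip (leU2 (woip_min_max p) (woip_min_max q)).

Fact woip_meetP p q r : (p <= woip_meet q r)%O = (p <= q)%O && (p <= r)%O.
Proof.
rewrite -{1}(woipE p) itv_le !lexI !woip_leE -!andbA.
by congr andb; rewrite andbCA.
Qed.

Fact woip_joinP p q r : (woip_join p q <= r)%O = (p <= r)%O && (q <= r)%O.
Proof.
rewrite -{1}(woipE r) itv_le !leUx !woip_leE -!andbA.
by congr andb; rewrite andbCA.
Qed.

End WoipLattice.

HB.instance Definition _ n :=
  Order.POrder_MeetJoin_isLattice.Build weak_display (woip n)
    (@woip_meetP n) (@woip_joinP n).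

Lemma itv_meet n (s s' t t' : wperm n) (le_s : (s <= s')%O) (le_t : (t <= t')%O) :
  (itv_woip le_s `&` itv_woip le_t)%O = itv_woip (leI2 le_s le_t).
Proof.
apply/val_inj; rewrite /= /itv_poset /=.
have [E1 E2] := itv_endpoints le_s; have [E3 E4] := itv_endpoints le_t.
by apply/val_inj; rewrite /= E1 E2 E3 E4.
Qed.

Lemma itv_join n (s s' t t' : wperm n) (le_s : (s <= s')%O) (le_t : (t <= t')%O) :
  (itv_woip le_s `|` itv_woip le_t)%O = itv_woip (leU2 le_s le_t).
Proof.
apply/val_inj; rewrite /= /itv_poset /=.
have [E1 E2] := itv_endpoints le_s; have [E3 E4] := itv_endpoints le_t.
by apply/val_inj; rewrite /= E1 E2 E3 E4.
Qed.

Definition sublattice d (L : latticeType d) (S : {pred L}) : Prop :=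
  Order.ClosedPredicates.meet_closed S /\ Order.ClosedPredicates.join_closed S.

Definition linear_extension n (p : poset n) (s : wperm n) : bool :=
  poset_set p \subset perm_set s.

Definition max_linear_extension n (p : poset n) (s : wperm n) : bool :=
  linear_extension p s &&
  [forall t : wperm n, linear_extension p t ==> (t <= s)%O].

Definition min_linear_extension n (p : poset n) (s : wperm n) : bool :=
  linear_extension p s &&
  [forall t : wperm n, linear_extension p t ==> (s <= t)%O].

Section PermutreePosets.
Variables (n : nat) (Op Om : {set 'I_n}).

Definition IPIPplus : {set poset n} :=
  [set p : poset n | [forall a : 'I_n, forall b : 'I_n, forall c : 'I_n,
     [&& a < b, b < c & b \in Op] ==> p a c ==> p a b]].

Definition IPIPminus : {set poset n} :=
  [set p : poset n | [forall a : 'I_n, forall b : 'I_n, forall c : 'I_n,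
     [&& a < b, b < c & b \in Om] ==> p a c ==> p b c]].

Definition DPIPplus : {set poset n} :=
  [set p : poset n | [forall a : 'I_n, forall b : 'I_n, forall c : 'I_n,
     [&& a < b, b < c & b \in Op] ==> p c a ==> p c b]].

Definition DPIPminus : {set poset n} :=
  [set p : poset n | [forall a : 'I_n, forall b : 'I_n, forall c : 'I_n,
     [&& a < b, b < c & b \in Om] ==> p c a ==> p b a]].

Definition appear (s : wperm n) (x y z : 'I_n) : bool :=
  (pos s x < pos s y) && (pos s y < pos s z).

Definition IPIPempty : {set poset n} :=
  [set p : poset n | [exists s : wperm n, [&& max_linear_extension p s,
     [forall a : 'I_n, forall b : 'I_n, forall c : 'I_n,
        [&& a < b, b < c & b \in Op] ==> ~~ appear s b a c]
   & [forall a : 'I_n, forall b : 'I_n, forall c : 'I_n,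
        [&& a < b, b < c & b \in Om] ==> ~~ appear s a c b]]]].

Definition DPIPempty : {set poset n} :=
  [set p : poset n | [exists s : wperm n, [&& min_linear_extension p s,
     [forall a : 'I_n, forall b : 'I_n, forall c : 'I_n,
        [&& a < b, b < c & b \in Op] ==> ~~ appear s b c a]
   & [forall a : 'I_n, forall b : 'I_n, forall c : 'I_n,
        [&& a < b, b < c & b \in Om] ==> ~~ appear s c a b]]]].

End PermutreePosets.

Variant epsilon := EpsEmpty | EpsMinus | EpsPlus | EpsBoth.

Definition IPIP n (Op Om : {set 'I_n}) (e : epsilon) : {set poset n} :=
  match e with
  | EpsEmpty => IPIPempty Op Om
  | EpsMinus => IPIPminus Om
  | EpsPlus => IPIPplus Op
  | EpsBoth => IPIPplus Op :&: IPIPminus Om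
  end.

Definition DPIP n (Op Om : {set 'I_n}) (e : epsilon) : {set poset n} :=
  match e with
  | EpsEmpty => DPIPempty Op Om
  | EpsMinus => DPIPminus Om
  | EpsPlus => DPIPplus Op
  | EpsBoth => DPIPplus Op :&: DPIPminus Om
  end.

(* Main.v *)
(** For a weak order interval poset with ends [s <= t] and [a < b], the relation
    [a -> b] holds iff [(a, b)] is not an inversion of [t], and [b -> a] holds
    iff [(a, b)] is an inversion of [s]; moreover [s] and [t] are its extremal
    linear extensions.  Hence every IPIP (resp. DPIP) condition says that the
    inversions of [t] (resp. [s]) are stable under enlarging (resp. shrinking)
    one end of an inversion.  The inversions of a join are the transitive closure
    of the union of the inversions, and moving an end of a chain only affects one
    of its steps, so such conditions pass to joins.  Reversing words complements
    inversions, which exchanges joins with meets and enlarging with shrinking. *)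
Require Import Defs.
From mathcomp Require Import all_boot all_order all_fingroup.
From mathcomp Require Import zify.

Set Implicit Arguments.
Unset Strict Implicit.
Unset Printing Implicit Defensive.

Import Order.Theory.

(** * Chains of a relation contained in [<], and moving their ends *)

Section RelationEnds.
Variable n : nat.
Implicit Types (O : {set 'I_n}) (R : rel 'I_n).

Definition extend_right O R :=
  forall a b c : 'I_n, a < b -> b < c -> b \in O -> R a b -> R a c.
Definition extend_left O R :=
  forall a b c : 'I_n, a < b -> b < c -> b \in O -> R b c -> R a c.
Definition shrink_right O R :=
  forall a b c : 'I_n, a < b -> b < c -> b \in O -> R a c -> R a b.
Definition shrink_left O R :=
  forall a b c : 'I_n, a < b -> b < c -> b \in O -> R a c -> R b c.

(** [connect] is reflexive; the conjunct [a < b] removes the diagonal, leaving the transitive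
    closure when [R] is contained in [<]. *)
Definition chain R : rel 'I_n := fun a b => (a < b) && connect R a b.

Variable R : rel 'I_n.
Hypothesis R_lt : forall a b : 'I_n, R a b -> a < b.

Lemma chain1 a b : R a b -> chain R a b.
Proof. by move=> ab; rewrite /chain R_lt //= connect1. Qed.

Lemma chain_trans : transitive (chain R).
Proof.
move=> b a c /andP [ab Cab] /andP [bc Cbc].
by rewrite /chain (ltn_trans ab bc) (connect_trans Cab).
Qed.

(** Peels off the first step of a path: since every step increases, what remains is again a chain
    unless it has already reached [b]. *)
Lemma chain_ind (Q : 'I_n -> 'I_n -> Prop) :
    (forall a b, R a b -> Q a b) ->
    (forall a x b, R a x -> chain R x b -> Q x b -> Q a b) ->
  forall a b, chain R a b -> Q a b.
Proof.
move=> Q1 QS a b /andP [+ /connectP [p + E]].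
elim: p a E => /= [|x p IH] a E ab; first by rewrite E ltnn in ab.
case/andP => Rax Pxp; have [xb|xb] := eqVneq x b; first by rewrite -xb; apply: Q1.
have Cxb : connect R x b by apply/connectP; exists p.
have lt_xb : x < b.
  rewrite ltn_neqAle xb /=; case: p Pxp E {IH Cxb} => [|y p] /= Pxp E.
    by rewrite E.
  have : path (fun u v : 'I_n => u < v) x (y :: p).
    by apply: (sub_path R_lt); rewrite /= Pxp.
  rewrite path_sortedE; last exact: ltn_trans.
  by case/andP => /allP /(_ b); rewrite E /= mem_last => /(_ isT) /ltnW.
by apply: (QS _ x) => //; [rewrite /chain lt_xb | apply: IH].
Qed.

(** [b] is either a vertex of the chain or strictly inside one step, and only that step has to be
    split by the cotransitivity of [R]. *)
Lemma chain_cotrans :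
    (forall a b c : 'I_n, a < b < c -> R a c -> R a b || R b c) ->
  forall a b c : 'I_n, a < b < c -> chain R a c -> chain R a b || chain R b c.
Proof.
move=> Rcotr a b c + Cac; elim/chain_ind: Cac b => {a c} [a c Rac|a x c Rax Cxc IH] b.
  by move=> abc; case/orP: (Rcotr _ _ _ abc Rac) => /chain1 ->; rewrite ?orbT.
case/andP => ab bc; case: (ltngtP b x) => [bx|xb|/val_inj ->].
- have abx : a < b < x by rewrite ab.
  case/orP: (Rcotr _ _ _ abx Rax) => /chain1; first by move->.
  by move=> Cbx; rewrite (chain_trans Cbx Cxc) orbT.
- have xbc : x < b < c by rewrite xb.
  case/orP: (IH b xbc) => [Cxb|->]; last by rewrite orbT.
  by rewrite (chain_trans (chain1 Rax) Cxb).
- by rewrite Cxc orbT.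
Qed.

(** Only the last step of the chain ends at [b]; it is extended and the earlier steps are kept. *)
Lemma chain_extend_right O : extend_right O R -> extend_right O (chain R).
Proof.
move=> RO a b c _ + + Cab; elim/chain_ind: Cab c => {a b} [a b|a x b].
  by move=> Rab c bc bO; apply/chain1/(RO a b c) => //; apply: R_lt.
by move=> Rax _ IH c bc bO; apply: chain_trans (chain1 Rax) (IH _ bc bO).
Qed.

(** Only the first step starts at [b]; it is replaced and the tail is kept. *)
Lemma chain_extend_left O : extend_left O R -> extend_left O (chain R).
Proof.
move=> RO a b c ab _ + Cbc; elim/chain_ind: Cbc ab => {b c} [b c|b x c].
  by move=> Rbc ab bO; apply/chain1/(RO a b c) => //; apply: R_lt.
move=> Rbx Cxc _ ab bO; apply: chain_trans Cxc.
by apply/chain1/(RO a b x) => //; apply: R_lt.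
Qed.

(** Steps beyond [b] are dropped, and a step straddling [b] is cut so as to end there. *)
Lemma chain_shrink_right O : shrink_right O R -> shrink_right O (chain R).
Proof.
move=> RO a b c + + + Cac; elim/chain_ind: Cac => {a c} [a c|a x c].
  by move=> Rac ab bc bO; apply/chain1/(RO a b c).
move=> Rax _ IH ab bc bO; case: (ltngtP x b) => [xb|bx|/val_inj <-].
- exact: chain_trans (chain1 Rax) (IH xb bc bO).
- exact/chain1/(RO a b x).
- exact: chain1.
Qed.

(** Steps before [b] are dropped, and a step straddling [b] is cut so as to start there. *)
Lemma chain_shrink_left O : shrink_left O R -> shrink_left O (chain R).
Proof.
move=> RO a b c + + + Cac; elim/chain_ind: Cac => {a c} [a c|a x c].
  by move=> Rac ab bc bO; apply/chain1/(RO a b c).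
move=> Rax Cxc IH ab bc bO; case: (ltngtP x b) => [xb|bx|/val_inj <- //].
  exact: IH.
by apply: chain_trans Cxc; apply/chain1/(RO a b x).
Qed.

End RelationEnds.

(** * Inversions of permutations: joins, word reversal, closure properties *)

Section Inversions.
Variable n : nat.
Implicit Types (s t r : wperm n) (a b c : 'I_n) (O : {set 'I_n}).

Definition inversion s : rel 'I_n := fun a b => (a < b) && (pos s b < pos s a).

Lemma inversion_lt s a b : inversion s a b -> a < b.
Proof. by case/andP. Qed.

Lemma le_inversionP s t :
  reflect (forall a b, inversion s a b -> inversion t a b) (s <= t)%O.
Proof. exact: wperm_leP. Qed.

Lemma pos_lt_inversion s a b : a < b -> (pos s a < pos s b) = ~~ inversion s a b.
Proof. by move=> ab; rewrite pos_ltE /inversion ab. Qed.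

Lemma pos_gt_inversion s a b : a < b -> (pos s b < pos s a) = inversion s a b.
Proof. by move=> ab; rewrite /inversion ab. Qed.

Definition inversionU s t : rel 'I_n :=
  fun a b => inversion s a b || inversion t a b.

Lemma inversionU_lt s t a b : inversionU s t a b -> a < b.
Proof. by case/orP => /inversion_lt. Qed.

Lemma inversion_trans s : transitive (inversion s).
Proof.
move=> b a c /andP [ab ba] /andP [bc cb].
by rewrite /inversion (ltn_trans ab bc) (ltn_trans cb ba).
Qed.

Lemma inversion_cotrans s a b c :
  a < b < c -> inversion s a c -> inversion s a b || inversion s b c.
Proof.
case/andP => ab bc /andP [_ ca]; rewrite /inversion ab bc /=.
by case: (ltnP (pos s b) (pos s a)) => //= /(leq_trans ca).
Qed.

(** The closure is transitive and cotransitive, so [inv_exists] realizes it by some [r]; this [r]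
    bounds [s] and [t], hence their join. Conversely, the inversions of the join contain those of
    [s] and [t] and are transitive. *)
Lemma inversion_join s t a b :
  inversion (s `|` t)%O a b = chain (inversionU s t) a b.
Proof.
have lt := @inversionU_lt s t.
apply/idP/idP => [|Cab].
  have [|||r Hr] := @inv_exists n (chain (inversionU s t)).
  - by move=> x y /andP [].
  - exact: chain_trans.
  - apply: chain_cotrans => // x y z xyz; rewrite /inversionU.
    by case/orP => /(inversion_cotrans xyz) /orP [] ->; rewrite ?orbT.
  have /le_inversionP H : (s `|` t <= r)%O.
    by rewrite leUx; apply/andP; split; apply/le_inversionP => x y xy;
       rewrite /inversion Hr; apply: chain1 => //; rewrite /inversionU xy ?orbT.
  by move/H; rewrite /inversion Hr.
have U x y : inversionU s t x y -> inversion (s `|` t)%O x y.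
  by case/orP; apply: le_inversionP; rewrite ?leUl ?leUr.
elim/(chain_ind lt): Cab => {a b} [a b /U //|a x b /U Rax _].
exact: inversion_trans.
Qed.

(** A product of permutations applies its left factor first, so positions are reversed and values
    kept: the word is read backwards. *)
Definition word_rev s : wperm n := (perm (@rev_ord_inj n) * s)%g.

Lemma word_revK : involutive word_rev.
Proof. exact: wrevK. Qed.

Lemma word_rev_le s t : (word_rev s <= word_rev t)%O = (t <= s)%O.
Proof. exact: wrev_le. Qed.

Lemma inversion_rev s a b : a < b -> inversion (word_rev s) a b = ~~ inversion s a b.
Proof.
have pos_rev u : pos (word_rev s) u = rev_ord (pos s u).
  apply: (@perm_inj _ (word_rev s)); rewrite /pos permKV /word_rev permM permE.
  by rewrite rev_ordK permKV.
move=> ab; rewrite -pos_gt_inversion // -pos_lt_inversion // !pos_rev /=.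
(* [rev_ord] sends [i] to [n - i.+1]; the bounds keep this subtraction from truncating. *)
by have := ltn_ord (pos s a); have := ltn_ord (pos s b); lia.
Qed.

(** An order-reversing involution exchanges greatest lower bounds and least upper bounds. *)
Lemma word_rev_meet s t :
  word_rev (s `&` t)%O = (word_rev s `|` word_rev t)%O.
Proof.
apply/le_anti/andP; split; last by rewrite leUx !word_rev_le leIl leIr.
rewrite -[(word_rev s `|` word_rev t)%O]word_revK word_rev_le lexI.
by rewrite -(word_rev_le s) -(word_rev_le t) !word_revK leUl leUr.
Qed.

(** Reversal negates both sides of the implication, and contraposition turns extending into
    shrinking. *)
Lemma extend_right_rev O s :
  extend_right O (inversion s) <-> shrink_right O (inversion (word_rev s)).
Proof.
split=> H a b c ab bc bO; have ac := ltn_trans ab bc.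
  by rewrite !inversion_rev //; apply/contra/H.
by apply: contraLR; rewrite -!inversion_rev //; apply: H.
Qed.

Lemma extend_left_rev O s :
  extend_left O (inversion s) <-> shrink_left O (inversion (word_rev s)).
Proof.
split=> H a b c ab bc bO; have ac := ltn_trans ab bc.
  by rewrite !inversion_rev //; apply/contra/H.
by apply: contraLR; rewrite -!inversion_rev //; apply: H.
Qed.

Definition meet_join_closed (P : wperm n -> Prop) :=
  forall s t, P s -> P t -> P (s `&` t)%O /\ P (s `|` t)%O.

Lemma meet_join_closed_and (P Q : wperm n -> Prop) :
  meet_join_closed P -> meet_join_closed Q ->
  meet_join_closed (fun s => P s /\ Q s).
Proof.
move=> HP HQ s t [Ps Qs] [Pt Qt].
by case: (HP s t Ps Pt) => ? ?; case: (HQ s t Qs Qt).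
Qed.

(** [K] passes to the union, then to its chains, then to the join through [inversion_join]. That
    identity is only pointwise, so [K] has to respect [=2]. *)
Lemma inversion_join_closed (K : rel 'I_n -> Prop) :
    (forall R R' : rel 'I_n, R =2 R' -> K R -> K R') ->
    (forall s t, K (inversion s) -> K (inversion t) -> K (inversionU s t)) ->
    (forall R : rel 'I_n, (forall a b : 'I_n, R a b -> a < b) -> K R -> K (chain R)) ->
  forall s t, K (inversion s) -> K (inversion t) -> K (inversion (s `|` t)%O).
Proof.
move=> Kext KU KC s t Ks Kt.
apply: (Kext (chain (inversionU s t))); first by move=> a b; rewrite inversion_join.
by apply: KC; [exact: inversionU_lt | exact: KU].
Qed.

Lemma extend_right_join O s t :
  extend_right O (inversion s) -> extend_right O (inversion t) ->
  extend_right O (inversion (s `|` t)%O).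
Proof.
apply: inversion_join_closed => {s t} [R R' E H|s t Hs Ht|R].
- by move=> a b c; rewrite -!E; apply: H.
- move=> a b c ab bc bO.
  by case/orP => [/Hs|/Ht] H; rewrite /inversionU (H c) ?orbT.
- by move=> R_lt; apply: chain_extend_right.
Qed.

Lemma extend_left_join O s t :
  extend_left O (inversion s) -> extend_left O (inversion t) ->
  extend_left O (inversion (s `|` t)%O).
Proof.
apply: inversion_join_closed => {s t} [R R' E H|s t Hs Ht|R].
- by move=> a b c; rewrite -!E; apply: H.
- move=> a b c ab bc bO.
  by case/orP => [/(Hs a)|/(Ht a)] H; rewrite /inversionU H ?orbT.
- by move=> R_lt; apply: chain_extend_left.
Qed.

Lemma shrink_right_join O s t :
  shrink_right O (inversion s) -> shrink_right O (inversion t) ->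
  shrink_right O (inversion (s `|` t)%O).
Proof.
apply: inversion_join_closed => {s t} [R R' E H|s t Hs Ht|R].
- by move=> a b c; rewrite -!E; apply: H.
- move=> a b c ab bc bO.
  by case/orP => [/(Hs a b)|/(Ht a b)] H; rewrite /inversionU H ?orbT.
- by move=> R_lt; apply: chain_shrink_right.
Qed.

Lemma shrink_left_join O s t :
  shrink_left O (inversion s) -> shrink_left O (inversion t) ->
  shrink_left O (inversion (s `|` t)%O).
Proof.
apply: inversion_join_closed => {s t} [R R' E H|s t Hs Ht|R].
- by move=> a b c; rewrite -!E; apply: H.
- move=> a b c ab bc bO.
  by case/orP => [/(Hs a b)|/(Ht a b)] H; rewrite /inversionU H ?orbT.
- by move=> R_lt; apply: chain_shrink_left.
Qed.

(** On reversed words the condition becomes shrinking and the meet becomes a join, so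
    [shrink_right_join] settles the meet. *)
Lemma extend_right_closed O : meet_join_closed (fun s => extend_right O (inversion s)).
Proof.
move=> s t Hs Ht; split; last exact: extend_right_join.
by apply/extend_right_rev; rewrite word_rev_meet;
   apply: shrink_right_join; apply/extend_right_rev.
Qed.

Lemma extend_left_closed O : meet_join_closed (fun s => extend_left O (inversion s)).
Proof.
move=> s t Hs Ht; split; last exact: extend_left_join.
by apply/extend_left_rev; rewrite word_rev_meet;
   apply: shrink_left_join; apply/extend_left_rev.
Qed.

Lemma shrink_right_closed O : meet_join_closed (fun s => shrink_right O (inversion s)).
Proof.
move=> s t Hs Ht; split; last exact: shrink_right_join.
(* [extend_right_rev] has its shrinking side on a reversed word, so the meet is first written as a
   double reversal. *)
rewrite -[(s `&` t)%O]word_revK; apply/extend_right_rev; rewrite word_rev_meet.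
by apply: extend_right_join; apply/extend_right_rev; rewrite word_revK.
Qed.

Lemma shrink_left_closed O : meet_join_closed (fun s => shrink_left O (inversion s)).
Proof.
move=> s t Hs Ht; split; last exact: shrink_left_join.
rewrite -[(s `&` t)%O]word_revK; apply/extend_left_rev; rewrite word_rev_meet.
by apply: extend_left_join; apply/extend_left_rev; rewrite word_revK.
Qed.

End Inversions.

(** * Interval posets read through their two ends *)

Section WoipEnds.
Variable n : nat.
Implicit Types (p q : woip n) (s t : wperm n) (a b c : 'I_n).

Lemma woip_relE p a b :
  woip_poset p a b =
  (pos (woip_min p) a <= pos (woip_min p) b) && (pos (woip_max p) a <= pos (woip_max p) b).
Proof. by rewrite -[in LHS](woipE p) /poset_rel /= !inE. Qed.

(** Inversions of the lower end are inversions of the upper end, so for an increasing pair the upper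
    end alone decides; for a decreasing pair the lower end does. *)
Lemma woip_inc p a b :
  a < b -> woip_poset p a b = ~~ inversion (woip_max p) a b.
Proof.
move=> ab; rewrite woip_relE !(leqNgt (pos _ a)) !pos_gt_inversion // -negb_or.
by congr negb; apply/orb_idl; apply/le_inversionP/woip_min_max.
Qed.

Lemma woip_dec p a b :
  a < b -> woip_poset p b a = inversion (woip_min p) a b.
Proof.
move=> ab; rewrite woip_relE !(leqNgt (pos _ b)) !pos_lt_inversion // !negbK.
by apply/andb_idr; apply/le_inversionP/woip_min_max.
Qed.

Lemma woip_linear_extension p s :
  linear_extension (woip_poset p) s = (woip_min p <= s <= woip_max p)%O.
Proof.
apply/subsetP/andP => [H|[/le_inversionP Hmin /le_inversionP Hmax]].
  have {}H a b : woip_poset p a b -> pos s a <= pos s b.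
    by move=> ab; have := H (a, b) ab; rewrite inE.
  split; apply/le_inversionP => a b /[dup] Iab /inversion_lt ab.
    have := H b a; rewrite woip_dec // => /(_ Iab).
    by rewrite leqNgt pos_lt_inversion // negbK.
  move: Iab; apply: contraLR; rewrite -woip_inc // => /H.
  by rewrite leqNgt pos_gt_inversion.
case=> a b; rewrite -[_ \in _]/(woip_poset p a b) inE /=.
case: (ltngtP a b) => [ab|ba|/val_inj -> //].
  rewrite woip_inc // leqNgt pos_gt_inversion //; exact/contra/Hmax.
by rewrite woip_dec // leqNgt pos_lt_inversion // negbK; exact: Hmin.
Qed.

Lemma woip_max_linear_extension p s :
  max_linear_extension (woip_poset p) s = (s == woip_max p).
Proof.
rewrite /max_linear_extension woip_linear_extension.
apply/andP/eqP => [[/andP [_ h] /forallP /(_ (woip_max p))]|->].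
  rewrite woip_linear_extension lexx woip_min_max /= => h'.
  by apply/le_anti; rewrite h.
rewrite woip_min_max lexx; split=> //; apply/forallP => t.
by rewrite woip_linear_extension; apply/implyP => /andP [].
Qed.

Lemma woip_min_linear_extension p s :
  min_linear_extension (woip_poset p) s = (s == woip_min p).
Proof.
rewrite /min_linear_extension woip_linear_extension.
apply/andP/eqP => [[/andP [h _] /forallP /(_ (woip_min p))]|->].
  rewrite woip_linear_extension lexx woip_min_max /= => h'.
  by apply/le_anti; rewrite h h'.
rewrite woip_min_max lexx; split=> //; apply/forallP => t.
by rewrite woip_linear_extension; apply/implyP => /andP [].
Qed.

(** Meets and joins of interval posets are computed end by end, and [itv_endpoints] recovers the
    ends of the result. *)
Lemma sublattice_max (P : wperm n -> Prop) (S : {set poset n}) :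
    meet_join_closed P ->
    (forall p, reflect (P (woip_max p)) (woip_poset p \in S)) ->
  sublattice [pred p : woip n | woip_poset p \in S].
Proof.
move=> HP PS; split=> p q; rewrite !inE => /PS Pp /PS Pq; apply/PS.
  rewrite (itv_endpoints (leI2 (woip_min_max p) (woip_min_max q))).2.
  by case: (HP _ _ Pp Pq).
rewrite (itv_endpoints (leU2 (woip_min_max p) (woip_min_max q))).2.
by case: (HP _ _ Pp Pq).
Qed.

Lemma sublattice_min (P : wperm n -> Prop) (S : {set poset n}) :
    meet_join_closed P ->
    (forall p, reflect (P (woip_min p)) (woip_poset p \in S)) ->
  sublattice [pred p : woip n | woip_poset p \in S].
Proof.
move=> HP PS; split=> p q; rewrite !inE => /PS Pp /PS Pq; apply/PS.
  rewrite (itv_endpoints (leI2 (woip_min_max p) (woip_min_max q))).1.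
  by case: (HP _ _ Pp Pq).
rewrite (itv_endpoints (leU2 (woip_min_max p) (woip_min_max q))).1.
by case: (HP _ _ Pp Pq).
Qed.

Lemma forall_tripleP (O : {set 'I_n}) (Q : 'I_n -> 'I_n -> 'I_n -> bool) :
  reflect (forall a b c, a < b -> b < c -> b \in O -> Q a b c)
    [forall a : 'I_n, forall b : 'I_n, forall c : 'I_n,
       [&& a < b, b < c & b \in O] ==> Q a b c].
Proof.
apply: (iffP forallP) => [H a b c ab bc bO|H a].
  by move/forallP/(_ b)/forallP/(_ c): (H a); rewrite ab bc bO.
by apply/forallP => b; apply/forallP => c; apply/implyP => /and3P []; apply: H.
Qed.

(** * Sign and pattern conditions as stability of the inversions of one end *)

Variables Op Om : {set 'I_n}.

(** By [woip_inc] increasing relations are non-inversions, so the defining implication is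
    contraposed. *)
Lemma IPIPplusP p :
  reflect (extend_right Op (inversion (woip_max p))) (woip_poset p \in IPIPplus Op).
Proof.
rewrite inE; apply: (iffP (forall_tripleP _ _)) => H a b c ab bc bO;
  have ac := ltn_trans ab bc; have := H a b c ab bc bO.
  by rewrite !woip_inc // => /implyP h; apply: contraLR.
by rewrite !woip_inc // => h; apply/implyP/contra.
Qed.

Lemma IPIPminusP p :
  reflect (extend_left Om (inversion (woip_max p))) (woip_poset p \in IPIPminus Om).
Proof.
rewrite inE; apply: (iffP (forall_tripleP _ _)) => H a b c ab bc bO;
  have ac := ltn_trans ab bc; have := H a b c ab bc bO.
  by rewrite !woip_inc // => /implyP h; apply: contraLR.
by rewrite !woip_inc // => h; apply/implyP/contra.
Qed.

(** By [woip_dec] decreasing relations are inversions, so the implication keeps its direction and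
    the condition is a shrinking one. *)
Lemma DPIPplusP p :
  reflect (shrink_left Op (inversion (woip_min p))) (woip_poset p \in DPIPplus Op).
Proof.
rewrite inE; apply: (iffP (forall_tripleP _ _)) => H a b c ab bc bO;
  have ac := ltn_trans ab bc; have := H a b c ab bc bO;
  by rewrite !woip_dec // => /implyP.
Qed.

Lemma DPIPminusP p :
  reflect (shrink_right Om (inversion (woip_min p))) (woip_poset p \in DPIPminus Om).
Proof.
rewrite inE; apply: (iffP (forall_tripleP _ _)) => H a b c ab bc bO;
  have ac := ltn_trans ab bc; have := H a b c ab bc bO;
  by rewrite !woip_dec // => /implyP.
Qed.

(** The pattern says that [(a, b)] is inverted and [(a, c)] is not; avoiding it is one instance of
    [extend_right]. *)
Lemma appear_bac s a b c : a < b -> b < c ->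
  ~~ appear s b a c = (inversion s a b ==> inversion s a c).
Proof.
move=> ab bc; have ac := ltn_trans ab bc; rewrite /appear
  (pos_gt_inversion s ab) (pos_lt_inversion s ac).
by rewrite negb_and negbK implybE.
Qed.

Lemma appear_acb s a b c : a < b -> b < c ->
  ~~ appear s a c b = (inversion s b c ==> inversion s a c).
Proof.
move=> ab bc; have ac := ltn_trans ab bc; rewrite /appear
  (pos_lt_inversion s ac) (pos_gt_inversion s bc).
by rewrite negb_and negbK implybE orbC.
Qed.

Lemma appear_bca s a b c : a < b -> b < c ->
  ~~ appear s b c a = (inversion s a c ==> inversion s b c).
Proof.
move=> ab bc; have ac := ltn_trans ab bc; rewrite /appear
  (pos_lt_inversion s bc) (pos_gt_inversion s ac).
by rewrite negb_and negbK implybE orbC.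
Qed.

Lemma appear_cab s a b c : a < b -> b < c ->
  ~~ appear s c a b = (inversion s a c ==> inversion s a b).
Proof.
move=> ab bc; have ac := ltn_trans ab bc; rewrite /appear
  (pos_gt_inversion s ac) (pos_lt_inversion s ab).
by rewrite negb_and negbK implybE.
Qed.

(** The only candidate for the maximal linear extension is [woip_max p], and avoiding the two
    patterns there amounts to the two extension conditions. *)
Lemma IPIPempty_woip p :
  (woip_poset p \in IPIPempty Op Om) = (woip_poset p \in IPIPplus Op :&: IPIPminus Om).
Proof.
rewrite in_setI [in LHS]inE; apply/existsP/andP => [[s]|].
  rewrite woip_max_linear_extension => /and3P [/eqP ->] /forall_tripleP Hp.
  move/forall_tripleP => Hm; split.
    apply/IPIPplusP => a b c ab bc bO; apply/implyP.
    by rewrite -appear_bac //; apply: Hp.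
  apply/IPIPminusP => a b c ab bc bO; apply/implyP.
  by rewrite -appear_acb //; apply: Hm.
case=> /IPIPplusP Hp /IPIPminusP Hm; exists (woip_max p).
rewrite woip_max_linear_extension eqxx /=.
apply/andP; split; apply/forall_tripleP => a b c ab bc bO.
  by rewrite appear_bac //; apply/implyP/Hp.
by rewrite appear_acb //; apply/implyP/Hm.
Qed.

Lemma DPIPempty_woip p :
  (woip_poset p \in DPIPempty Op Om) = (woip_poset p \in DPIPplus Op :&: DPIPminus Om).
Proof.
rewrite in_setI [in LHS]inE; apply/existsP/andP => [[s]|].
  rewrite woip_min_linear_extension => /and3P [/eqP ->] /forall_tripleP Hp.
  move/forall_tripleP => Hm; split.
    apply/DPIPplusP => a b c ab bc bO; apply/implyP.
    by rewrite -appear_bca //; apply: Hp.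
  apply/DPIPminusP => a b c ab bc bO; apply/implyP.
  by rewrite -appear_cab //; apply: Hm.
case=> /DPIPplusP Hp /DPIPminusP Hm; exists (woip_min p).
rewrite woip_min_linear_extension eqxx /=.
apply/andP; split; apply/forall_tripleP => a b c ab bc bO.
  by rewrite appear_bca //; apply/implyP/Hp.
by rewrite appear_cab //; apply/implyP/Hm.
Qed.

Lemma IPIPbothP p :
  reflect (extend_right Op (inversion (woip_max p)) /\
           extend_left Om (inversion (woip_max p)))
    (woip_poset p \in IPIPplus Op :&: IPIPminus Om).
Proof.
rewrite in_setI; apply: (iffP andP) => -[].
  by move=> /IPIPplusP ? /IPIPminusP.
by move=> /IPIPplusP ? /IPIPminusP.
Qed.

Lemma DPIPbothP p :
  reflect (shrink_left Op (inversion (woip_min p)) /\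
           shrink_right Om (inversion (woip_min p)))
    (woip_poset p \in DPIPplus Op :&: DPIPminus Om).
Proof.
rewrite in_setI; apply: (iffP andP) => -[].
  by move=> /DPIPplusP ? /DPIPminusP.
by move=> /DPIPplusP ? /DPIPminusP.
Qed.

End WoipEnds.

Theorem theorem87 (n : nat) (Op Om : {set 'I_n}) (e : epsilon) :
  sublattice [pred p : woip n | woip_poset p \in IPIP Op Om e] /\
  sublattice [pred p : woip n | woip_poset p \in DPIP Op Om e].
Proof.
have closed_inc := meet_join_closed_and (@extend_right_closed n Op) (@extend_left_closed n Om).
have closed_dec := meet_join_closed_and (@shrink_left_closed n Op) (@shrink_right_closed n Om).
split; case: e => /=.
(* On interval posets [EpsEmpty] imposes the same condition as [EpsBoth]. *)
- by apply: (sublattice_max closed_inc) => p; rewrite IPIPempty_woip; apply: IPIPbothP.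
- by apply: (sublattice_max (@extend_left_closed n Om)) => p; apply: IPIPminusP.
- by apply: (sublattice_max (@extend_right_closed n Op)) => p; apply: IPIPplusP.
- by apply: (sublattice_max closed_inc) => p; apply: IPIPbothP.
- by apply: (sublattice_min closed_dec) => p; rewrite DPIPempty_woip; apply: DPIPbothP.
- by apply: (sublattice_min (@shrink_right_closed n Om)) => p; apply: DPIPminusP.
- by apply: (sublattice_min (@shrink_left_closed n Op)) => p; apply: DPIPplusP.
- by apply: (sublattice_min closed_dec) => p; apply: DPIPbothP.
Qed.
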